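(* One has $\rho_{\mathcal{W}}=\sigma_{\mathcal{W}}$. Thus there exist a fixed $\varepsilon>0$ and infinitely many $m$ with $E_\varepsilon(\mathcal{V}_m)\ge0$ if and only if there are a constant $\kappa>0$ and finite sets $S_j\subseteq\mathcal{W}$ ($j=1,2,\dots$) such that $$D(S_j)\longrightarrow\infty\qquad\text{and}\qquad \log B(S_j)\ \ge\ \kappa\,D(S_j)\log2\ \text{ for infinitely many } j,$$ the last inequality being equivalent to $B(S_j)\ge2^{\kappa D(S_j)}$.
   Context: For $m\ge2$, $\mathcal{V}_m=(1,2^m-1,2^m)$. For a triple $(a,b,c)$ of positive integers with $a+b=c$ and $\varepsilon>0$, $E_\varepsilon(a,b,c)=\log c-(1+\varepsilon)\log\mathrm{rad}(abc)$, where $\mathrm{rad}(n)$ is the product of the distinct primes dividing $n$. For an odd prime $p$, let $d_p$ be the multiplicative order of $2$ modulo $p$ and $A_p=v_p(2^{d_p}-1)$, with $v_p$ the $p$-adic valuation. $\mathcal{W}$ is the set of Wieferich primes, i.e. odd primes $p$ with $2^{p-1}\equiv1\pmod{p^2}$, and $\mathcal{W}(m)=\{p\in\mathcal{W}:p\mid2^m-1\}$. Put $\Omega_m=\sum_{p\in\mathcal{W}(m)}(A_p-1)\log p$ (empty sum $=0$) and $\rho_{\mathcal{W}}=\limsup_{m\to\infty}\Omega_m/(m\log2)$. For a finite set $S\subseteq\mathcal{W}$ put $D(S)=\mathrm{lcm}_{p\in S}d_p$ and $B(S)=\prod_{p\in S}p^{A_p-1}$, with $D(\varnothing)=B(\varnothing)=1$.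 A sequence $(S_j)$ of finite subsets of $\mathcal{W}$ is admissible when $D(S_j)\to\infty$. Define $$\sigma_{\mathcal{W}}=\sup_{(S_j)\text{ admissible}}\ \limsup_{j\to\infty}\frac{\log B(S_j)}{D(S_j)\log2},$$ with value $0$ if no admissible sequence exists. *)

(* Defs.v *)
From HB Require Import structures.
From mathcomp Require Import all_boot all_order all_algebra all_fingroup finmap.
From mathcomp Require Import all_classical all_reals all_analysis.

Set Implicit Arguments.
Unset Strict Implicit.
Unset Printing Implicit Defensive.

Import Order.TTheory GRing.Theory Num.Theory.
Import numFieldNormedType.Exports.

Local Open Scope classical_set_scope.
Local Open Scope ring_scope.

Definition nrad (n : nat) : nat := (\prod_(p <- primes n) p)%N.

Definition Vtriple (m : nat) : nat * nat * nat := (1, 2 ^ m - 1, 2 ^ m)%N.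

(* Meant for triples of positive integers with a + b = c. *)
Definition excess {R : realType} (eps : R) (t : nat * nat * nat) : R :=
  let: (a, b, c) := t in
  ln c%:R - (1 + eps) * ln (nrad (a * b * c)%N)%:R.

(* For an odd prime p, 2%:R is a unit of 'F_p and this is its multiplicative
   order; otherwise the value is irrelevant. *)
Definition ord2 (p : nat) : nat := #[insubd (1%g : {unit 'F_p}) (2%:R : 'F_p)]%g.

Definition Aexp (p : nat) : nat := logn p (2 ^ ord2 p - 1)%N.

Definition wieferich (p : nat) : bool :=
  [&& prime p, odd p & (2 ^ (p - 1) == 1 %[mod p ^ 2])%N].

(* The index set is the set of Wieferich primes dividing 2 ^ m - 1 (m >= 1);
   truncated subtraction is harmless since 0 < Aexp p for every odd prime p. *)
Definition Omega {R : realType} (m : nat) : R :=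
  \sum_(p <- primes (2 ^ m - 1)%N | wieferich p) (Aexp p - 1)%:R * ln p%:R.

Definition rhoW {R : realType} : \bar R :=
  limn_esup (fun m : nat => (Omega m / (m%:R * ln 2))%:E).

Definition sub_wieferich (S : {fset nat}) : Prop :=
  forall p, p \in S -> wieferich p.

Definition Dlcm (S : {fset nat}) : nat := \big[lcmn/1%N]_(p <- S) ord2 p.

Definition Bprod (S : {fset nat}) : nat := (\prod_(p <- S) p ^ (Aexp p - 1))%N.

Definition admissible (S : nat -> {fset nat}) : Prop :=
  (forall j, sub_wieferich (S j)) /\ Dlcm (S j) @[j --> \oo] --> \oo.

Definition sigma_seq {R : realType} (S : nat -> {fset nat}) : \bar R :=
  limn_esup (fun j : nat =>
    (ln (Bprod (S j))%:R / ((Dlcm (S j))%:R * ln 2))%:E).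

(* The supremum of the empty set in \bar R is -oo, hence the case split. *)
Definition sigmaW {R : realType} : \bar R :=
  if `[< exists S, admissible S >]
  then ereal_sup [set sigma_seq S | S in admissible]
  else 0%E.

(* Main.v *)
Require Import Defs.
From HB Require Import structures.
From mathcomp Require Import all_boot all_order all_algebra all_fingroup finmap.
From mathcomp Require Import cyclic ring lra zify.
From mathcomp Require Import all_classical all_reals all_analysis.

(** Let W(m) be the set of Wieferich primes dividing 2 ^ m - 1.  Then
    Omega(m) = log B(W(m)), so rho is about the particular sets W(m), sigma
    about all finite sets S of Wieferich primes.  The two families dominate
    each other.  On the one hand D(W(m)) divides m, so the ratio
    log B / (D log 2) of W(m) is at least Omega(m) / (m log 2).  On the other
    hand p divides 2 ^ m - 1 iff d_p divides m, so S is contained in W(D(S))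
    and log B(S) <= Omega(D(S)) ([Bprod_le]).

    A limit superior exceeds c only if its terms are >= c infinitely often, so
    everything is reduced, for each real c > 0, to an equivalence
    ([dense_OmegaP]): Omega(m) >= c m log 2 for infinitely many m iff some
    admissible sequence S_j satisfies log B(S_j) >= c D(S_j) log 2 for
    infinitely many j.  From right to left take m = D(S_j), which is unbounded
    by admissibility.  From left to right take S_j = W(m_j) with m_j > j; this
    is admissible because B(S) <= 2 ^ D(S) always ([Bprod_le_pow2]), whence
    D(W(m)) log 2 >= Omega(m) >= c m log 2.  As rho and sigma are both
    nonnegative, comparing them with every c > 0 gives rho = sigma
    ([rhoW_eq_sigmaW]).

    For the excess, lifting the exponent gives
    v_p(2 ^ m - 1) = A_p + v_p(m / d_p), and A_p > 1 exactly for Wieferich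
    primes.  Hence 2 ^ m - 1 lies between rad(2 ^ m - 1) B(W(m)) and
    rad(2 ^ m - 1) B(W(m)) m ([nrad_Bprod_le], [le_nrad_Bprod]), that is,
    log rad(2 ^ m - 1) = m log 2 - Omega(m) up to O(log m).  So the excess is
    nonnegative infinitely often for some epsilon > 0 iff Omega(m) >= c m log 2
    infinitely often for some c > 0 ([excess_dense]). *)

Set Implicit Arguments.
Unset Strict Implicit.
Unset Printing Implicit Defensive.

Import Order.TTheory GRing.Theory Num.Theory.
Import numFieldNormedType.Exports.

Local Open Scope classical_set_scope.
Local Open Scope ring_scope.

(** * Lifting the exponent *)

(** With x = y + 1, the cofactor x ^ (k - 1) + ... + x + 1 of x - 1 in
    x ^ k - 1 is congruent to k modulo p, hence prime to p. *)
Lemma logn_expS1_coprime (p y k : nat) :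
  prime p -> (p %| y)%N -> (0 < y)%N -> ~~ (p %| k)%N ->
  logn p (y.+1 ^ k).-1 = logn p y.
Proof.
move=> pp py y0 pk; rewrite predn_exp /=.
have sk : (\sum_(i < k) y.+1 ^ i = k %[mod p])%N.
  rewrite -[in RHS](card_ord k) -sum1_card big_mkcond /=.
  rewrite -modn_summ -[in RHS]modn_summ; congr (_ %% p)%N.
  by apply: eq_bigr => i _; rewrite -modnXm -addn1 -modnDml (eqP py) modnXm exp1n.
have nps : ~~ (p %| \sum_(i < k) y.+1 ^ i)%N by rewrite /dvdn sk.
rewrite lognM //; last by case: (\sum_(i < k) _)%N nps => //; rewrite dvdn0.
by rewrite (@logn_coprime p (\sum_(i < k) _)%N) ?addn0// prime_coprime.
Qed.

(** With x = y + 1, the cofactor x ^ (p - 1) + ... + x + 1 of x - 1 is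
    congruent modulo p ^ 2 to p + y p (p - 1) / 2, hence to p: here p must be
    odd for p to divide p (p - 1) / 2.  So p divides it exactly once. *)
Lemma logn_expS1_prime (p y : nat) :
  prime p -> odd p -> (p %| y)%N -> (0 < y)%N ->
  logn p (y.+1 ^ p).-1 = (logn p y).+1.
Proof.
move=> pp op py y0; rewrite predn_exp /=.
have p2 : (2 < p)%N by rewrite ltn_neqAle prime_gt1// andbT; case: eqP op => // <-.
have lin i : (y.+1 ^ i = 1 + i * y %[mod p ^ 2])%N.
  elim: i => [|i ih]; first by rewrite expn0 mul0n addn0.
  rewrite expnS -modnMmr ih modnMmr.
  have -> : (y.+1 * (1 + i * y) = i * (y ^ 2) + (1 + i.+1 * y))%N.
    by rewrite -mulnn; ring.
  by rewrite -modnDml -modnMmr (eqP (dvdn_exp2r 2 py)) muln0 mod0n add0n.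
have sk : (\sum_(i < p) y.+1 ^ i = p %[mod p ^ 2])%N.
  rewrite -modn_summ (eq_bigr (fun i : 'I_p => (1 + i * y) %% p ^ 2)%N); last first.
    by move=> i _; exact: lin.
  rewrite modn_summ big_split /= sum1_card card_ord -big_distrl /=.
  have -> : (\sum_(i < p) i = 'C(p, 2))%N by rewrite -bin2_sum big_mkord.
  rewrite -modnDmr (_ : _ * y %% p ^ 2 = 0)%N ?addn0//; apply/eqP.
  by rewrite -/(dvdn _ _) -mulnn dvdn_mul// prime_dvd_bin.
have s0 : (0 < \sum_(i < p) y.+1 ^ i)%N.
  by rewrite -(prednK (prime_gt0 pp)) big_ord_recl.
rewrite lognM // -[RHS]addn1; congr addn; apply/eqP; rewrite eqn_leq.
rewrite leqNgt -!pfactor_dvdn// expn1 /dvdn sk modn_small ?andbT; last first.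
  by rewrite -{1}(expn1 p) ltn_exp2l ?prime_gt1.
rewrite -lt0n prime_gt0//= -(@modn_dvdm (p ^ 2)) ?dvdn_exp//.
by rewrite sk modn_dvdm ?dvdn_exp// modnn.
Qed.

(** Lifting the exponent.  Write k = u p ^ v with u prime to p: each of the v
    successive p-th powers adds one to the valuation, the u-th power nothing. *)
Lemma logn_expS1 (p y k : nat) :
  prime p -> odd p -> (p %| y)%N -> (0 < y)%N -> (0 < k)%N ->
  logn p (y.+1 ^ k).-1 = (logn p y + logn p k)%N.
Proof.
move=> pp op py y0 k0.
have pw v : [/\ (p %| (y.+1 ^ (p ^ v)).-1)%N, (0 < (y.+1 ^ (p ^ v)).-1)%N
    & logn p (y.+1 ^ (p ^ v)).-1 = (logn p y + v)%N].
  elim: v => [|v [h1 h2 h3]]; first by rewrite expn0 expn1 addn0.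
  have h : logn p (y.+1 ^ (p ^ v.+1)).-1 = (logn p y + v.+1)%N.
    have := logn_expS1_prime pp op h1 h2.
    by rewrite prednK ?expn_gt0// -expnM -expnSr h3 addnS.
  have : (0 < logn p (y.+1 ^ (p ^ v.+1)).-1)%N by rewrite h addnS.
  by rewrite logn_gt0 mem_primes => /and3P[].
have [u pu ->] := pfactor_coprime pp k0.
have [h1 h2 h3] := pw (logn p k).
rewrite lognM ?pfactor_gt0//; last by case: u pu => //; rewrite prime_coprime// dvdn0.
rewrite (logn_coprime pu) pfactorK// add0n.
rewrite mulnC expnM -h3 -(logn_expS1_coprime (k := u) pp h1 h2); last first.
  by rewrite -prime_coprime.
by rewrite prednK ?expn_gt0.
Qed.

(** * The order of 2 and the valuation of 2 ^ m - 1 *)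

Lemma dvdn_ord2 (p m : nat) : prime p -> odd p ->
  (ord2 p %| m)%N = (p %| 2 ^ m - 1)%N.
Proof.
move=> pp op; rewrite /ord2 order_dvdn -val_eqE /= FinRing.val_unitX.
have chp := pchar_Fp pp.
rewrite val_insubd ifT; last first.
  rewrite unitfE -(dvdn_pcharf chp) gtnNdvd//.
  by rewrite ltn_neqAle prime_gt1// andbT; case: eqP op => // <-.
rewrite -natrX (dvdn_pcharf chp) natrB ?expn_gt0//.
by rewrite subr_eq0.
Qed.

Lemma ord2_gt0 p : (0 < ord2 p)%N. Proof. exact: order_gt0. Qed.

Lemma logn_pow2_sub1 (p m : nat) : prime p -> odd p -> (0 < m)%N ->
  (p %| 2 ^ m - 1)%N ->
  logn p (2 ^ m - 1) = (Aexp p + logn p (m %/ ord2 p))%N.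
Proof.
move=> pp op m0 pm; have := pm; rewrite -dvdn_ord2// => dm.
have d0 := ord2_gt0 p.
have pd : (p %| (2 ^ ord2 p).-1)%N by rewrite -subn1 -dvdn_ord2.
have h : (1 < 2 ^ ord2 p)%N by rewrite -{1}(expn0 2) ltn_exp2l.
rewrite /Aexp -{1}(divnK dm) mulnC expnM !subn1 -logn_expS1//.
- by rewrite prednK// ltnW.
- by rewrite -ltnS prednK// ltnW.
- by rewrite divn_gt0// dvdn_leq.
Qed.

Lemma Aexp_gt0 p : prime p -> odd p -> (0 < Aexp p)%N.
Proof.
move=> pp op; rewrite /Aexp logn_gt0 mem_primes pp -dvdn_ord2// dvdnn subn_gt0.
by rewrite -{1}(expn0 2) ltn_exp2l// ord2_gt0.
Qed.

(** The exponent p - 1 is a multiple of d_p that is prime to p, so 2 ^ (p - 1) - 1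
    has the same p-adic valuation A_p as 2 ^ d_p - 1. *)
Lemma wieferichE p : prime p -> odd p -> wieferich p = (1 < Aexp p)%N.
Proof.
move=> pp op; rewrite /wieferich pp op /=.
have p1 := prime_gt1 pp; have p10 : (0 < p - 1)%N by rewrite subn_gt0.
have pf : (p %| 2 ^ (p - 1) - 1)%N.
  rewrite -eqn_mod_dvd ?expn_gt0// subn1 -totient_prime//.
  by apply/eqP/Euler_exp_totient; rewrite coprime2n.
rewrite eqn_mod_dvd ?expn_gt0// pfactor_dvdn//; last first.
  by rewrite subn_gt0 -{1}(expn0 2) ltn_exp2l.
rewrite logn_pow2_sub1// (logn_div p (m := ord2 p)) ?dvdn_ord2//.
by rewrite [logn p (p - 1)]lognE gtnNdvd ?andbF ?sub0n ?addn0// subn1 prednK // ltnW.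
Qed.

(** * The Wieferich part of 2 ^ m - 1 *)

(** Powers of distinct primes are coprime, so their product divides whatever
    each of them divides. *)
Lemma prod_prime_pow_dvdn (s : seq nat) (e : nat -> nat) (n : nat) :
  uniq s -> {in s, forall p, prime p} -> {in s, forall p, p ^ e p %| n}%N ->
  (\prod_(p <- s) p ^ e p %| n)%N.
Proof.
elim: s => [|q s ih] /=; first by rewrite big_nil dvd1n.
case/andP=> qs us ps ds; rewrite big_cons Gauss_dvd.
  rewrite ds ?mem_head// ih// => p sp; [apply: ps|apply: ds];
  by rewrite inE sp orbT.
apply: coprimeXl; rewrite big_seq.
apply: (big_ind (fun k => coprime q k)) => [|a b qa qb|p sp].
- exact: coprimen1.
- by rewrite coprimeMr qa.
apply: coprimeXr; rewrite prime_coprime ?ps ?mem_head//.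
rewrite dvdn_prime2 ?ps ?mem_head// ?inE ?sp ?orbT//.
by apply: contraNneq qs => ->.
Qed.

Lemma prod_primes_logn n : (0 < n)%N -> (\prod_(p <- primes n) p ^ logn p n)%N = n.
Proof. by move=> n0; rewrite [RHS]prod_prime_decomp// prime_decompE big_map. Qed.

Lemma pow2_sub1_gt0 m : (0 < m)%N -> (0 < 2 ^ m - 1)%N.
Proof. by move=> m0; rewrite subn_gt0 -{1}(expn0 2) ltn_exp2l. Qed.

Lemma odd_primes_pow2_sub1 m p : p \in primes (2 ^ m - 1) ->
  [/\ prime p, odd p, (0 < m)%N & (p %| 2 ^ m - 1)%N].
Proof.
rewrite mem_primes => /and3P[pp]; case: m => [//|m] _ pd; split => //.
by apply: dvdn_odd pd _; rewrite oddB ?expn_gt0// oddX.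
Qed.

Definition wief_part (m : nat) : {fset nat} :=
  [fset p in [seq p <- primes (2 ^ m - 1) | wieferich p]]%fset.

Lemma mem_wief_part m p :
  (p \in wief_part m) = wieferich p && (p \in primes (2 ^ m - 1)).
Proof. by rewrite in_fset /= mem_filter. Qed.

Lemma perm_wief_part m :
  perm_eq (wief_part m) [seq p <- primes (2 ^ m - 1) | wieferich p].
Proof.
apply: uniq_perm; rewrite ?fset_uniq ?filter_uniq ?primes_uniq//.
by move=> p; rewrite mem_wief_part mem_filter.
Qed.

Lemma wief_part_wieferich m : sub_wieferich (wief_part m).
Proof. by move=> p; rewrite mem_wief_part => /andP[]. Qed.

Lemma Dlcm_dvdn (S : {fset nat}) n :
  reflect {in S, forall p, ord2 p %| n}%N (Dlcm S %| n)%N.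
Proof.
apply: (iffP idP) => [dn p pS|]; rewrite /Dlcm.
  by apply: dvdn_trans dn; rewrite /Dlcm (big_rem p)//= dvdn_lcml.
rewrite big_seq => dn; apply: (big_ind (fun k => k %| n)%N) => //.
by move=> a b an bn; rewrite dvdn_lcm an.
Qed.

Lemma Dlcm_gt0 (S : {fset nat}) : (0 < Dlcm S)%N.
Proof.
rewrite /Dlcm; apply: (big_ind (fun k => 0 < k)%N) => // [a b a0 b0|p _].
  by rewrite lcmn_gt0 a0.
exact: ord2_gt0.
Qed.

Lemma Dlcm_wief_part m : (Dlcm (wief_part m) %| m)%N.
Proof.
apply/Dlcm_dvdn => p; rewrite mem_wief_part => /andP[_].
by move=> /odd_primes_pow2_sub1[pp op _]; rewrite dvdn_ord2.
Qed.

Lemma Bprod_gt0 (S : {fset nat}) : sub_wieferich S -> (0 < Bprod S)%N.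
Proof.
move=> wS; rewrite /Bprod big_seq; apply: prodn_cond_gt0 => p /wS /and3P[pp _ _].
by rewrite expn_gt0 prime_gt0.
Qed.

(** Non-Wieferich primes have A_p = 1 and contribute a factor 1. *)
Lemma Bprod_wief_part m :
  Bprod (wief_part m) = (\prod_(p <- primes (2 ^ m - 1)) p ^ (Aexp p - 1))%N.
Proof.
rewrite /Bprod (perm_big _ (perm_wief_part m)) /= big_filter.
rewrite [LHS]big_seq_cond [RHS]big_seq big_mkcondr /=; apply: eq_bigr => p.
move=> /odd_primes_pow2_sub1[pp op _ _].
rewrite wieferichE//; case: ltnP => // A1.
by rewrite (eqP (_ : Aexp p - 1 == 0)%N) ?subn_eq0.
Qed.

(** Since d_p divides D(S) for each p in S, the set S is contained in the
    Wieferich part of 2 ^ D(S) - 1. *)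
Lemma Bprod_le (S : {fset nat}) : sub_wieferich S ->
  (Bprod S <= Bprod (wief_part (Dlcm S)))%N.
Proof.
move=> wS; apply: dvdn_leq; first by rewrite Bprod_gt0//; exact: wief_part_wieferich.
apply: prod_prime_pow_dvdn; first exact: fset_uniq.
  by move=> p /wS /and3P[].
move=> p pS; have wp := wS _ pS; have /and3P[pp op _] := wp.
rewrite /Bprod (big_rem p) ?dvdn_mulr//= mem_wief_part wp mem_primes pp.
rewrite pow2_sub1_gt0 ?Dlcm_gt0//= -dvdn_ord2//.
by have /Dlcm_dvdn := dvdnn (Dlcm S); apply.
Qed.

(** Each prime p of 2 ^ m - 1 occurs with exponent at least A_p = 1 + (A_p - 1). *)
Lemma nrad_Bprod_le m : (0 < m)%N ->
  (nrad (2 ^ m - 1) * Bprod (wief_part m) <= 2 ^ m - 1)%N.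
Proof.
move=> m0; have n0 := pow2_sub1_gt0 m0.
rewrite Bprod_wief_part /nrad -big_split /= -[leqRHS]prod_primes_logn//.
rewrite big_seq [leqRHS]big_seq; apply: leq_prod => p.
move=> /odd_primes_pow2_sub1[pp op _ pd].
rewrite -expnS (subn1 (Aexp p)) prednK ?Aexp_gt0// leq_pexp2l ?prime_gt0//.
by rewrite logn_pow2_sub1// leq_addr.
Qed.

(** Each prime p of 2 ^ m - 1 occurs with exponent at most
    1 + (A_p - 1) + v_p(m), and the product of the p ^ v_p(m) divides m. *)
Lemma le_nrad_Bprod m : (0 < m)%N ->
  (2 ^ m - 1 <= nrad (2 ^ m - 1) * Bprod (wief_part m) * m)%N.
Proof.
move=> m0; have n0 := pow2_sub1_gt0 m0.
apply: (@leq_trans (nrad (2 ^ m - 1) * Bprod (wief_part m) *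
    \prod_(p <- primes (2 ^ m - 1)) p ^ logn p m)).
  rewrite Bprod_wief_part /nrad -!big_split /= -[leqLHS]prod_primes_logn//.
  rewrite big_seq [leqRHS]big_seq; apply: leq_prod => p.
  move=> /odd_primes_pow2_sub1[pp op _ pd].
  rewrite -expnS (subn1 (Aexp p)) prednK ?Aexp_gt0// -expnD leq_pexp2l ?prime_gt0//.
  rewrite logn_pow2_sub1// leq_add2l dvdn_leq_log//.
  by apply: dvdn_div; rewrite dvdn_ord2.
rewrite leq_mul2l dvdn_leq ?orbT//; apply: prod_prime_pow_dvdn.
- exact: primes_uniq.
- by move=> p; rewrite mem_primes => /andP[].
- by move=> p _; exact: pfactor_dvdnn.
Qed.

Lemma nrad_gt0 n : (0 < nrad n)%N.
Proof.
rewrite /nrad big_seq; apply: prodn_cond_gt0 => p.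
by rewrite mem_primes => /andP[/prime_gt0].
Qed.

(** This bound makes sets with large B have large D; it is what
    yields admissibility in [dense_OmegaP]. *)
Lemma Bprod_le_pow2 (S : {fset nat}) : sub_wieferich S ->
  (Bprod S <= 2 ^ Dlcm S)%N.
Proof.
move=> wS; have D0 := Dlcm_gt0 S; apply: leq_trans (Bprod_le wS) _.
apply: leq_trans (leq_subr 1 _); apply: leq_trans (nrad_Bprod_le D0).
exact/leq_pmull/nrad_gt0.
Qed.

Lemma nrad_Vtriple m : (0 < m)%N ->
  nrad (1 * (2 ^ m - 1) * 2 ^ m) = (2 * nrad (2 ^ m - 1))%N.
Proof.
move=> m0; rewrite mul1n /nrad.
rewrite (perm_big (2%N :: primes (2 ^ m - 1))) ?big_cons//.
apply: uniq_perm; rewrite /= ?primes_uniq// ?andbT.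
  by apply/negP => /odd_primes_pow2_sub1[].
move=> p; rewrite primesM ?pow2_sub1_gt0 ?expn_gt0// primesX// orbC.
by rewrite primes_prime// !inE.
Qed.

(** * Limits superior and infinitely many indices *)

Lemma infinite_set_natP (A : set nat) :
  infinite_set A <-> forall N, exists2 n, (N <= n)%N & A n.
Proof.
split=> [infA N|unbA /finite_seqP[s sA]].
  apply: contrapT => noA; apply: infA.
  apply: (@sub_finite_set _ _ `I_N); last exact: finite_II.
  by move=> n An /=; rewrite ltnNge; apply/negP => Nn; apply: noA; exists n.
have [n sn] := unbA (\max_(k <- s) k).+1.
rewrite sA /= => ns; move: sn; rewrite ltnNge => /negP; apply.
exact: (@leq_bigmax_seq _ s xpredT id n).
Qed.

Lemma limn_esup_ge (R : realType) (u : (\bar R)^nat) (c : \bar R) :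
  infinite_set [set n | c <= u n]%E -> (c <= limn_esup u)%E.
Proof.
move=> /infinite_set_natP infu; apply: le_ereal_inf_tmp => _ [V [N _ NV] <-].
have [n Nn cn] := infu N; apply: le_trans cn _.
by apply: ereal_sup_ubound; exists n => //; exact: NV.
Qed.

Lemma limn_esup_gt (R : realType) (u : (\bar R)^nat) (c : \bar R) :
  (c < limn_esup u)%E -> infinite_set [set n | c <= u n]%E.
Proof.
move=> cu; apply/infinite_set_natP => N; apply: contrapT => noN.
move: cu; rewrite ltNge => /negP; apply; apply: ge_ereal_inf.
exists (ereal_sup (u @` [set n | (N <= n)%N])).
  by exists [set n | (N <= n)%N] => //; exists N.
apply: ge_ereal_sup => _ [n Nn <-]; rewrite leNgt; apply/negP => cn.
by apply: noN; exists n => //=; exact: ltW.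
Qed.

(** Testing only positive real thresholds suffices when the larger side is
    nonnegative; this is how densities are compared below. *)
Lemma lee_pos_below (R : realType) (x y : \bar R) : (0 <= y)%E ->
  (forall c : R, 0 < c -> (c%:E < x)%E -> (c%:E <= y)%E) -> (x <= y)%E.
Proof.
move=> y0 h; rewrite leNgt; apply/negP; case: y y0 h => [y| |] //=.
  rewrite lee_fin => y0 h yx.
  have [c [yc cx]] : exists c : R, y < c /\ (c%:E < x)%E.
    case: x yx {h} => [x| |] //; last by exists (y + 1); rewrite ltry; split => //; lra.
    rewrite lte_fin => yx; exists ((y + x) / 2); rewrite lte_fin; split; lra.
  have := h c (le_lt_trans y0 yc) cx.
  by rewrite lee_fin leNgt yc.
by move=> _ _; rewrite ltNge leey.
Qed.

(** * Comparison of the two densities *)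

Section Density.
Variable R : realType.
Implicit Types (c : R) (S : nat -> {fset nat}).

Let ln2_gt0 : 0 < ln 2 :> R. Proof. by rewrite ln_gt0// ltr1n. Qed.

Lemma ln_natM (a b : nat) : (0 < a)%N -> (0 < b)%N ->
  ln (a * b)%N%:R = ln a%:R + ln b%:R :> R.
Proof. by move=> a0 b0; rewrite natrM lnM// posrE ltr0n. Qed.

Lemma ln_natX (a n : nat) : (0 < a)%N -> ln (a ^ n)%N%:R = n%:R * ln a%:R :> R.
Proof. by move=> a0; rewrite natrX lnXn ?ltr0n// mulr_natl. Qed.

Lemma ler_ln_nat (a b : nat) : (0 < a)%N -> (a <= b)%N -> ln a%:R <= ln b%:R :> R.
Proof.
by move=> a0 ab; rewrite ler_ln ?posrE ?ltr0n ?ler_nat//; exact: leq_trans ab.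
Qed.

Lemma ln_prod_nat (s : seq nat) (F : nat -> nat) :
  {in s, forall i, 0 < F i}%N ->
  ln (\prod_(i <- s) F i)%N%:R = \sum_(i <- s) ln (F i)%:R :> R.
Proof.
elim: s => [|i s ih] F0; first by rewrite !big_nil ln1.
have Fs : {in s, forall k, 0 < F k}%N by move=> k ks; rewrite F0// inE ks orbT.
rewrite !big_cons ln_natM ?ih ?F0 ?mem_head//.
by rewrite big_seq prodn_cond_gt0.
Qed.

Lemma OmegaE m : Omega m = ln (Bprod (wief_part m))%:R :> R.
Proof.
have p0 p : p \in wief_part m -> (0 < p)%N.
  by move=> /wief_part_wieferich/andP[/prime_gt0].
rewrite /Omega /Bprod ln_prod_nat; last by move=> p /p0 pp; rewrite expn_gt0 pp.
rewrite -big_filter -(perm_big _ (perm_wief_part m)) big_seq [RHS]big_seq.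
by apply: eq_bigr => p /p0 pp; rewrite ln_natX.
Qed.

Lemma ln_Bprod_ge0 (S : {fset nat}) : sub_wieferich S -> 0 <= ln (Bprod S)%:R :> R.
Proof. by move=> /Bprod_gt0 B0; rewrite ln_ge0// ler1n. Qed.

Lemma Omega_ge0 m : 0 <= Omega m :> R.
Proof. by rewrite OmegaE ln_Bprod_ge0//; exact: wief_part_wieferich. Qed.

Lemma Omega_Dlcm_ge (S : {fset nat}) : sub_wieferich S ->
  ln (Bprod S)%:R <= Omega (Dlcm S) :> R.
Proof. by move=> wS; rewrite OmegaE ler_ln_nat ?Bprod_gt0// Bprod_le. Qed.

Lemma ln_Bprod_le (S : {fset nat}) : sub_wieferich S ->
  ln (Bprod S)%:R <= (Dlcm S)%:R * ln 2 :> R.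
Proof.
by move=> wS; rewrite -ln_natX// ler_ln_nat ?Bprod_gt0// Bprod_le_pow2.
Qed.

Definition dense_Omega c := infinite_set [set m : nat | c * m%:R * ln 2 <= Omega m].

Definition dense_seq c S :=
  infinite_set [set j : nat | c * (Dlcm (S j))%:R * ln 2 <= ln (Bprod (S j))%:R].

(** The heart of the matter: at a positive threshold, the sets W(m) and
    arbitrary admissible sequences perform equally well.  The index D(S_j)
    serves in one direction, the sets W(m_j) with m_j > j in the other, where
    D(W(m_j)) >= c m_j forces admissibility. *)
Lemma dense_OmegaP c : 0 < c ->
  dense_Omega c <-> exists2 S, admissible S & dense_seq c S.
Proof.
move=> c0; split=> [/infinite_set_natP inf|[S [wS DS] inf]]; last first.
  apply/infinite_set_natP => N.
  have /cvgnyPge/(_ N) [J _ JN] := DS.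
  have [j Jj hj] := (infinite_set_natP _).1 inf J.
  exists (Dlcm (S j)); first exact: JN.
  by apply: le_trans hj _; exact: Omega_Dlcm_ge.
have /choice[f hf] : forall j : nat, exists m, (j < m)%N /\ c * m%:R * ln 2 <= Omega m.
  by move=> j; have [m jm hm] := inf j.+1; exists m.
have wW j : sub_wieferich (wief_part (f j)) by exact: wief_part_wieferich.
exists (fun j => wief_part (f j)); last first.
  apply/infinite_set_natP => N; exists N => //=.
  have [fN hN] := hf N; rewrite -OmegaE; apply: le_trans hN.
  rewrite ler_pM2r// ler_pM2l// ler_nat dvdn_leq//; first exact: leq_trans fN.
  exact: Dlcm_wief_part.
split=> //; apply/cvgnyPge => A.
(* From c (f j) <= D(W(f j)) and j < f j, D is at least A once j >= A / c. *)
exists (Num.truncn (A%:R / c)).+1 => // j /= Aj.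
have [fj hj] := hf j; rewrite -(ler_nat R).
have h : c * (f j)%:R <= (Dlcm (wief_part (f j)))%:R.
  rewrite -(ler_pM2r ln2_gt0); apply: le_trans hj _.
  by rewrite OmegaE ln_Bprod_le.
apply: le_trans h; rewrite mulrC -ler_pdivrMr//.
have /ltW/le_trans -> // := truncnS_gt (A%:R / c).
by rewrite ler_nat; apply: leq_trans Aj _; exact: ltnW.
Qed.

(** At m = 0 the ratio is 0 / 0 = 0 while the inequality without division
    holds trivially; infinitude ignores that index. *)
Lemma dense_OmegaE c : 0 < c -> dense_Omega c <->
  infinite_set [set m : nat | c%:E <= (Omega m / (m%:R * ln 2))%:E]%E.
Proof.
move=> c0; split=> /infinite_set_natP inf; apply/infinite_set_natP => N;
  have [[//|m] Nm hm] := inf N.+1; exists m.+1; rewrite 1?ltnW//=;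
  move: hm; rewrite /= lee_fin ler_pdivlMr ?mulrA//;
  by rewrite mulr_gt0// ltr0n.
Qed.

Lemma dense_seqE c S :
  dense_seq c S =
  infinite_set [set j | c%:E <= (ln (Bprod (S j))%:R / ((Dlcm (S j))%:R * ln 2))%:E]%E.
Proof.
rewrite /dense_seq; congr (~ finite_set _); apply/funext => j /=.
by rewrite lee_fin ler_pdivlMr ?mulrA// mulr_gt0// ltr0n Dlcm_gt0.
Qed.

Lemma infinite_nonneg (u : nat -> R) : (forall n, 0 <= u n) ->
  infinite_set [set n | 0 <= (u n)%:E]%E.
Proof.
by move=> u0; apply/infinite_set_natP => N; exists N; rewrite //= lee_fin.
Qed.

Lemma rhoW_ge0 : (0 <= @rhoW R)%E.
Proof.
apply: limn_esup_ge; apply: infinite_nonneg => m.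
by rewrite divr_ge0 ?Omega_ge0// mulr_ge0// ltW.
Qed.

Lemma sigma_seq_ge0 S : admissible S -> (0 <= @sigma_seq R S)%E.
Proof.
move=> [wS _]; apply: limn_esup_ge; apply: infinite_nonneg => m.
by rewrite divr_ge0 ?ln_Bprod_ge0// mulr_ge0// ltW.
Qed.

Lemma sigmaW_ge S : admissible S -> (@sigma_seq R S <= @sigmaW R)%E.
Proof.
move=> aS; rewrite /sigmaW ifT; last by apply/asboolP; exists S.
by apply: ereal_sup_ubound; exists S.
Qed.

Lemma sigmaW_ge0 : (0 <= @sigmaW R)%E.
Proof.
rewrite /sigmaW; case: asboolP => // -[S aS].
by apply: le_trans (sigma_seq_ge0 aS) _; apply: ereal_sup_ubound; exists S.
Qed.

Lemma sigmaW_gt c : 0 < c -> (c%:E < @sigmaW R)%E ->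
  exists2 S, admissible S & (c%:E < @sigma_seq R S)%E.
Proof.
move=> c0; rewrite /sigmaW; case: asboolP => _.
  by move=> /ereal_sup_gt[_ [S aS <-]]; exists S.
by rewrite lte_fin ltNge ltW.
Qed.

Lemma rhoW_eq_sigmaW : @rhoW R = @sigmaW R.
Proof.
apply/eqP; rewrite eq_le; apply/andP; split.
  apply: lee_pos_below sigmaW_ge0 _ => c c0 /limn_esup_gt /(dense_OmegaE c0).
  move=> /(dense_OmegaP c0)[S aS]; rewrite dense_seqE => /limn_esup_ge /le_trans.
  by apply; exact: sigmaW_ge.
apply: lee_pos_below rhoW_ge0 _ => c c0 /(sigmaW_gt c0)[S aS /limn_esup_gt].
rewrite -dense_seqE => dS; apply: limn_esup_ge; apply/(dense_OmegaE c0).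
by apply/(dense_OmegaP c0); exists S.
Qed.

(** * Nonnegative excess and positive density *)

Lemma excess_VtripleE (eps : R) m : (0 < m)%N ->
  excess eps (Vtriple m) =
  m%:R * ln 2 - (1 + eps) * (ln 2 + ln (nrad (2 ^ m - 1))%:R).
Proof.
move=> m0; rewrite /excess /Vtriple nrad_Vtriple// ln_natM ?ln_natX//.
exact: nrad_gt0.
Qed.

Lemma ln_nrad_le m : (0 < m)%N ->
  ln (nrad (2 ^ m - 1))%:R + Omega m <= m%:R * ln 2 :> R.
Proof.
move=> m0; have B0 := Bprod_gt0 (@wief_part_wieferich m).
rewrite OmegaE -ln_natM ?nrad_gt0// -ln_natX// ler_ln_nat ?muln_gt0 ?nrad_gt0//.
exact: leq_trans (nrad_Bprod_le m0) (leq_subr _ _).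
Qed.

Lemma le_ln_nrad m : (0 < m)%N ->
  m%:R * ln 2 <= ln 2 + ln (nrad (2 ^ m - 1))%:R + Omega m + ln m%:R :> R.
Proof.
move=> m0; have B0 := Bprod_gt0 (@wief_part_wieferich m).
have r0 := nrad_gt0 (2 ^ m - 1).
rewrite OmegaE -ln_natM// -ln_natM ?muln_gt0// -ln_natM ?muln_gt0 ?r0//.
rewrite -ln_natX// ler_ln_nat ?expn_gt0// -!mulnA.
apply: leq_trans (_ : 2 * (2 ^ m - 1) <= _)%N; last first.
  by rewrite leq_mul2l/= mulnA le_nrad_Bprod.
have := pow2_sub1_gt0 m0; lia.
Qed.

(** As ln x <= x at x = m / K, one has ln m <= m / K + ln K for every K > 0.
    With K = 2 / d the first term is d m / 2, and so is a bound for the second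
    one once m >= K |ln K|. *)
Lemma ln_nat_small (d : R) : 0 < d ->
  exists N : nat, forall m, (N <= m)%N -> ln m%:R <= d * m%:R :> R.
Proof.
move=> d0; pose K := 2 / d; have K0 : 0 < K by rewrite divr_gt0.
exists (Num.truncn (K * `|ln K|)).+2 => m hm.
have m0 : (0 < m)%N by exact: leq_trans hm.
have hK : K * `|ln K| <= m%:R.
  apply: le_trans (ltW (truncnS_gt _)) _; rewrite ler_nat; exact: ltnW.
have -> : m%:R = K * (m%:R / K) :> R by rewrite mulrC divfK// gt_eqF.
rewrite lnM ?posrE ?divr_gt0 ?ltr0n//.
have h1 : ln (m%:R / K) <= m%:R / K :> R.
  have := @le_ln1Dx R (m%:R / K - 1); rewrite (addrC 1) subrK.
  have : 0 < m%:R / K by rewrite divr_gt0 ?ltr0n.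
  by move=> ? /(_ _); lra.
have h2 : ln K <= m%:R / K.
  by rewrite ler_pdivlMr// mulrC (le_trans _ hK)// ler_pM2l// ler_norm.
have -> : d * (K * (m%:R / K)) = m%:R / K + m%:R / K.
  by rewrite /K; field; rewrite gt_eqF.
exact: lerD.
Qed.

(** Put M = m log 2.  If the excess is nonnegative then
    log 2 + log rad <= M / (1 + e), so that
    Omega(m) >= M e / (1 + e) - log m, and half of the constant e / (1 + e)
    absorbs log m for large m.  Conversely Omega(m) >= c M gives
    log rad <= (1 - c) M; then e = c / 2 works, because
    (1 + c / 2) (1 - c) <= 1 - c / 2 and c M / 2 exceeds the remaining
    (1 + c / 2) log 2 for large m. *)
Lemma excess_dense : (exists2 eps : R, 0 < eps &
    infinite_set [set m : nat | (2 <= m)%N /\ 0 <= excess eps (Vtriple m)]) <->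
  exists2 c, 0 < c & dense_Omega c.
Proof.
split=> [[e e0 /infinite_set_natP inf]|[c c0 /infinite_set_natP inf]].
  pose d := e / (1 + e); have d0 : 0 < d by rewrite divr_gt0// addr_gt0.
  exists (d / 2); first by rewrite divr_gt0.
  have [|N0 hN0] := @ln_nat_small (d / 2 * ln 2).
    exact: mulr_gt0 (divr_gt0 d0 _) ln2_gt0.
  apply/infinite_set_natP => N; have [m Nm [m2]] := inf (maxn N N0).
  have m0 : (0 < m)%N by exact: ltnW.
  rewrite geq_max in Nm; have [Nm' N0m] := andP Nm.
  rewrite excess_VtripleE// => hm; exists m => //=.
  have hr := le_ln_nrad m0; have hs := hN0 m N0m.
  set M := m%:R * ln 2 in hm hr; set r := ln 2 + _ in hm hr.
  have : d * M <= Omega m + ln m%:R :> R.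
    have -> : d * M = M - M / (1 + e) by rewrite /d; field; rewrite gt_eqF// addr_gt0.
    suff : r <= M / (1 + e) by lra.
    by rewrite ler_pdivlMr ?addr_gt0// mulrC; lra.
  have -> : d / 2 * m%:R * ln 2 = d * M / 2 by rewrite /M; field.
  have hdM : d / 2 * ln 2 * m%:R = d * M / 2 by rewrite /M; field.
  rewrite hdM in hs.
  lra.
exists (c / 2); first by rewrite divr_gt0.
apply/infinite_set_natP => N.
have [m Nm hm] := inf (maxn (maxn N 2) (Num.truncn ((1 + c / 2) * (2 / c))).+1).
rewrite !geq_max in Nm; have /andP[/andP[Nm' m2] cm] := Nm.
have m0 : (0 < m)%N by exact: ltnW.
exists m => //; split=> //; rewrite excess_VtripleE//; have hr := ln_nrad_le m0.
have hK : (1 + c / 2) * (2 / c) <= m%:R.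
  by apply: le_trans (ltW (truncnS_gt _)) _; rewrite ler_nat.
have hl : (1 + c / 2) * ln 2 <= c / 2 * (m%:R * ln 2).
  rewrite mulrA ler_pM2r//.
  have -> : 1 + c / 2 = c / 2 * ((1 + c / 2) * (2 / c)) by field; rewrite gt_eqF.
  by rewrite ler_pM2l// divr_gt0.
rewrite /= -mulrA in hm; move: hm hr hl.
set M := m%:R * ln 2; set r := ln _%:R; move=> hm hr hl.
have M0 : 0 <= M by rewrite mulr_ge0// ltW.
have : (1 + c / 2) * r <= (1 + c / 2) * (M - c * M).
  by rewrite ler_pM2l ?addr_gt0 ?divr_gt0//; lra.
have : 0 <= c ^+ 2 / 2 * M by rewrite mulr_ge0// divr_ge0// sqr_ge0.
by rewrite mulrBr !mulrDl !mulrDr; lra.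
Qed.

End Density.

Theorem theorem6p11 (R : realType) :
  [/\ @rhoW R = @sigmaW R,
      (exists2 eps : R, 0 < eps &
         infinite_set [set m : nat | (2 <= m)%N /\ 0 <= excess eps (Vtriple m)])
      <->
      (exists kappa : R, exists S : nat -> {fset nat},
         [/\ 0 < kappa,
             forall j, sub_wieferich (S j),
             Dlcm (S j) @[j --> \oo] --> \oo &
             infinite_set [set j : nat |
               kappa * (Dlcm (S j))%:R * ln 2 <= ln (Bprod (S j))%:R]])
    & forall (kappa : R) (S : {fset nat}), 0 < kappa -> sub_wieferich S ->
        (kappa * (Dlcm S)%:R * ln 2 <= ln (Bprod S)%:R <->
         2 `^ (kappa * (Dlcm S)%:R) <= (Bprod S)%:R)].
Proof.
split; first exact: rhoW_eq_sigmaW.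
- rewrite excess_dense; split=> [[c c0 /(dense_OmegaP c0)[S [wS DS] dS]]|].
    by exists c, S.
  move=> [c [S [c0 wS DS dS]]]; exists c => //.
  by apply/(dense_OmegaP c0); exists S.
- move=> k S _ /Bprod_gt0 B0.
  by rewrite -ln_powR ler_ln ?posrE ?powR_gt0 ?ltr0n.
Qed.
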